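(* Let $D\in\mathbb{R}^{n\times n}$ be symmetric and let $Z_D\subset\mathcal{S}$ be a finite set of (normalized) eigenvectors of $D$ such that for every $w\in Z_D$ one has $w\cdot z=0$ for all $z\in Z_D\setminus\{w\}$. Then for any choice of parameters $t:Z_D\to[0,\infty)$ with $\sum_{z\in Z_D}t(z)=1$ the measure $$\mu=\frac12\sum_{z\in Z_D}t(z)\,(\delta_z+\delta_{-z})$$ is a stationary point of $\mathcal{E}_D$.
   Context: $\mathcal{S}=\{x\in\mathbb{R}^n:\|x\|=1\}$ is the Euclidean unit sphere, $\delta_z$ is the Dirac measure at $z$, $P_x^\perp=\mathrm{Id}-xx^T$ for $x\in\mathcal{S}$, and $\mathcal{E}_D(\mu)=\int_{\mathcal{S}}\int_{\mathcal{S}}e^{x\cdot Dy}\,d\mu(x)\,d\mu(y)$ for Borel probability measures $\mu$ on $\mathcal{S}$. For a Lipschitz vector field $V:\mathbb{R}^n\to\mathbb{R}^n$, the first variation is $d\mathcal{E}_D(\mu;V)=\frac{d}{dt}\mathcal{E}_D(\mu_t)\big|_{t=0}$, where $\mu_t$ is the (unique) weak solution of $\partial_t\mu_t+\nabla\cdot(\mu_tP_x^\perp V)=0$, $\mu_0=\mu$, i.e. $\frac{d}{dt}\int_{\mathcal{S}}\varphi\,d\mu_t=\int_{\mathcal{S}}P_x^\perp\nabla\varphi(x)\cdot V(x)\,d\mu_t(x)$ for continuously differentiable $\varphi$. A probability measure $\mu$ on $\mathcal{S}$ is a stationary point of $\mathcal{E}_D$ if $d\mathcal{E}_D(\mu;V)=0$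 for all Lipschitz continuous $V$. *)

(* Defs.v *)
From HB Require Import structures.
From mathcomp Require Import all_boot all_order all_algebra.
From mathcomp Require Import finmap.
From mathcomp Require Import all_classical all_reals all_analysis.

Set Implicit Arguments.
Unset Strict Implicit.
Unset Printing Implicit Defensive.

Import Order.TTheory GRing.Theory Num.Theory.
Import numFieldNormedType.Exports.

Local Open Scope classical_set_scope.
Local Open Scope ring_scope.

Section euclidean.
Context {R : realType} {n : nat}.
Implicit Types x y z : 'cV[R]_n.

Definition dot x y : R := (x^T *m y) 0 0.

(* The norm [`|x|] that the library puts on matrices is the sup norm. *)
Definition enorm x : R := Num.sqrt (dot x x).

Definition sphere : set 'cV[R]_n := [set x | enorm x = 1].

Definition tangent_proj x : 'M[R]_n := 1%:M - x *m x^T.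

Definition gradient (phi : 'cV[R]_n -> R) x : 'cV[R]_n :=
  \col_i 'D_(delta_mx i 0) phi x.

Definition C1 (phi : 'cV[R]_n -> R) : Prop :=
  (forall x, differentiable phi x) /\ continuous (gradient phi).

Definition eigenvector (D : 'M[R]_n) z : Prop :=
  z != 0 /\ exists a : R, D *m z = a *: z.

End euclidean.

Definition borelE (R : realType) (n : nat) := g_sigma_algebraType (@open 'cV[R]_n).
HB.instance Definition _ (R : realType) (n : nat) := Measurable.on (borelE R n).

Section energy.
Context {R : realType} {n : nat}.
Local Notation E := (borelE R n).
Implicit Types (mu : {measure set E -> \bar R}) (D : 'M[R]_n).

(* Borel probability measures on the sphere are identified with the Borel
   probability measures on R^n that give full mass to the sphere. *)
Definition sphere_probability mu : Prop :=
  mu [set: E] = 1%E /\ mu (sphere : set E) = 1%E.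

Definition energy D mu : R :=
  \int[mu]_(x in (sphere : set E)) \int[mu]_(y in (sphere : set E))
    expR (dot (x : 'cV[R]_n) (D *m y)).

(* Time runs over the whole line, so that the derivatives at 0 are two-sided;
   the test functions are the C^1 functions on the ambient space. *)
Definition weak_solution (V : 'cV[R]_n -> 'cV[R]_n) mu
    (mu_ : R -> {measure set E -> \bar R}) : Prop :=
  [/\ forall t, sphere_probability (mu_ t),
      forall A, measurable A -> mu_ 0 A = mu A
    & forall phi, C1 phi -> forall t : R,
        is_derive t 1
          (fun s => \int[mu_ s]_(x in (sphere : set E)) phi x)
          (\int[mu_ t]_(x in (sphere : set E))
             dot (tangent_proj x *m gradient phi x) (V x))].

(* The weak solution exists and is unique for Lipschitz [V]; the derivative is
   therefore taken along every weak solution. *)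
Definition is_first_variation D mu (V : 'cV[R]_n -> 'cV[R]_n) (l : R) : Prop :=
  forall mu_ : R -> {measure set E -> \bar R}, weak_solution V mu mu_ ->
    is_derive (0 : R) 1 (fun t => energy D (mu_ t)) l.

Definition stationary_point D mu : Prop :=
  sphere_probability mu /\
  forall V : 'cV[R]_n -> 'cV[R]_n, lipschitz V -> is_first_variation D mu V 0.

End energy.

Section symmetric_atoms.
Context {R : realType} {n : nat}.
Local Notation E := (borelE R n).
Local Open Scope ereal_scope.
Variables (Z : {fset 'cV[R]_n}) (t : 'cV[R]_n -> {nonneg R}).

Definition symmetric_atoms (A : set E) : \bar R :=
  (2^-1)%:E * \sum_(z <- Z) (t z)%:num%:E * (\d_(z : E) A + \d_(- z : E)%R A).

Let half_ge0 : (0 <= 2^-1 :> R)%R. Proof. by rewrite invr_ge0. Qed.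

Let atom (z : 'cV[R]_n) : {measure set E -> \bar R} :=
  mscale (t z) (measure_add (dirac (z : E)) (dirac ((- z)%R : E))).

Let total : {measure set E -> \bar R} :=
  mscale (NngNum half_ge0) (msum (fun i => atom (nth 0%R Z i)) (size Z)).

Let symmetric_atomsE : symmetric_atoms = total.
Proof.
apply/funext => A; rewrite /symmetric_atoms /total /= /mscale /= /msum.
congr (_ * _); rewrite (big_nth 0%R) big_mkord; apply: eq_bigr => i _.
rewrite /atom /= /mscale /=; congr (_ * _); exact/esym/measure_addE.
Qed.

Let symmetric_atoms0 : symmetric_atoms set0 = 0.
Proof. by rewrite symmetric_atomsE measure0. Qed.

Let symmetric_atoms_ge0 A : 0 <= symmetric_atoms A.
Proof. by rewrite symmetric_atomsE. Qed.

Let symmetric_atoms_sigma_additive : semi_sigma_additive symmetric_atoms.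
Proof. by rewrite symmetric_atomsE; exact: measure_semi_sigma_additive. Qed.

HB.instance Definition _ := isMeasure.Build _ E R symmetric_atoms
  symmetric_atoms0 symmetric_atoms_ge0 symmetric_atoms_sigma_additive.

End symmetric_atoms.

(* Main.v *)
Require Import Defs.
From HB Require Import structures.
From mathcomp Require Import all_boot all_order all_algebra.
From mathcomp Require Import finmap.
From mathcomp Require Import all_classical all_reals all_analysis.
From mathcomp Require Import measurable_realfun ring lra.
Import Order.TTheory GRing.Theory Num.Theory.
Import numFieldNormedType.Exports.
Local Open Scope classical_set_scope.
Local Open Scope ring_scope.

(** Write [h_rho x] for the potential of [rho], the integral of [exp (x . D y)]
    in [rho (dy)], so that the energy of [rho] is the [rho]-integral of [h_rho].
    Let [mu_s] be a weak solution starting at the symmetric measure [mu]. As [D]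
    is symmetric, the [mu]-integral of [h_rho] is the [rho]-integral of [h_mu]
    ([potential_symmetric_atoms_duality]), and expanding the energy around [mu]
    gives
<<
      E (mu_s) - E (mu) = 2 \int h_mu d(mu_s - mu)
                          + \int (h_(mu_s) - h_mu) d(mu_s - mu).
>>
    The potential [h_mu] is an admissible test function ([C1_potential]), so the
    derivative at [0] of the linear term is twice the [mu]-integral of the
    tangential gradient of [h_mu] against [V]. This vanishes because the
    gradient of [h_mu] is normal to the sphere at every atom: by orthogonality
    and the symmetry of [mu], only the pair [z], [- z] contributes to the
    gradient at [z], and the contribution is a multiple of [D z], hence of [z]
    ([tangential_gradient_potential_atoms]).

    The quadratic term is at most a multiple of [s ^+ 2]. Indeed averages of a
    test function against [mu_s] are Lipschitz in [s], with a constant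
    proportional to the supremum of its gradient on the sphere
    ([weak_solution_time_lipschitz]). Applied to the derivatives of the kernel,
    this bounds the gradient of [h_(mu_s) - h_mu] on the sphere by a multiple of
    [s] ([gradient_potential_time_lipschitz]); applied to [h_(mu_s) - h_mu]
    itself, it gives the second factor. *)

(** * Scalar product, sup norm and unit sphere *)

Section euclidean_theory.
Context {R : realType} {n : nat}.
Implicit Types (x y z c g h : 'cV[R]_n) (A : 'M[R]_n).

Lemma dotE x y : dot x y = \sum_i x i 0 * y i 0.
Proof. by rewrite /dot mxE; apply: eq_bigr => i _; rewrite mxE. Qed.

Lemma dotC x y : dot x y = dot y x.
Proof. by rewrite !dotE; apply: eq_bigr => i _; rewrite mulrC. Qed.

Lemma dotDr x y z : dot x (y + z) = dot x y + dot x z.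
Proof. by rewrite /dot mulmxDr mxE. Qed.

Lemma dotZr a x y : dot x (a *: y) = a * dot x y.
Proof. by rewrite /dot -scalemxAr mxE. Qed.

Lemma dotDl x y z : dot (x + y) z = dot x z + dot y z.
Proof. by rewrite dotC dotDr !(dotC z). Qed.

Lemma dotZl a x y : dot (a *: x) y = a * dot x y.
Proof. by rewrite dotC dotZr dotC. Qed.

Lemma dotNr x y : dot x (- y) = - dot x y.
Proof. by rewrite -scaleN1r dotZr mulN1r. Qed.

Lemma dotNl x y : dot (- x) y = - dot x y.
Proof. by rewrite dotC dotNr dotC. Qed.

Lemma dot_delta i x : dot (delta_mx i 0) x = x i 0.
Proof.
rewrite dotE (bigD1 i)//= big1 ?addr0 => [|j ji]; rewrite mxE ?eqxx ?mul1r//=.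
by rewrite (negPf ji) mul0r.
Qed.

Lemma dot_mulmxr A x y : dot x (A *m y) = dot (A^T *m x) y.
Proof. by rewrite /dot trmx_mul trmxK mulmxA. Qed.

Lemma coord_le_norm m p (A : 'M[R]_(m, p)) i j : `|A i j| <= `|A|.
Proof.
rewrite [leRHS]/Num.norm/= mx_normrE; exact: (le_bigmax _ _ (i, j)).
Qed.

Lemma norm_le_coord x (b : R) :
  0 <= b -> (forall i, `|x i 0| <= b) -> `|x| <= b.
Proof.
move=> b0 xb; rewrite [leLHS]/Num.norm/= mx_normrE; apply: bigmax_le => //.
by move=> [i j] _; rewrite (ord1 j) xb.
Qed.

(** Norms are sup norms here, so the factor [n] bounds a sum of [n] products;
    the same factor replaces Cauchy-Schwarz in [dot_norm_le]. *)
Lemma mulmx_norm_le A x : `|A *m x| <= n%:R * `|A| * `|x|.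
Proof.
apply: norm_le_coord => [|i]; first by rewrite !mulr_ge0.
rewrite mxE (le_trans (ler_norm_sum _ _ _))//.
rewrite -mulrA mulr_natl -[X in _ *+ X]card_ord -sumr_const.
by apply: ler_sum => j _; rewrite normrM ler_pM// coord_le_norm.
Qed.

Lemma dot_norm_le x y : `|dot x y| <= n%:R * `|x| * `|y|.
Proof.
rewrite dotE (le_trans (ler_norm_sum _ _ _))//.
rewrite -mulrA mulr_natl -[X in _ *+ X]card_ord -sumr_const.
by apply: ler_sum => j _; rewrite normrM ler_pM// coord_le_norm.
Qed.

Lemma sphereE x : sphere x <-> dot x x = 1.
Proof.
rewrite /sphere /enorm /=; split=> [x1|->]; last exact: sqrtr1.
have x0 : 0 <= dot x x.
  by rewrite dotE sumr_ge0// => i _; rewrite -expr2 sqr_ge0.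
by rewrite -(sqr_sqrtr x0) x1 expr1n.
Qed.

Lemma sphere_norm_le1 x : sphere x -> `|x| <= 1.
Proof.
move=> /sphereE x1; apply: norm_le_coord => // i.
rewrite -(@expr_le1 _ 2)// -normrX ger0_norm ?sqr_ge0// -x1 dotE (bigD1 i)//=.
by rewrite -expr2 lerDl sumr_ge0// => j _; rewrite -expr2 sqr_ge0.
Qed.

Lemma sphereN x : sphere x -> sphere (- x).
Proof. by move=> /sphereE x1; apply/sphereE; rewrite dotNl dotNr opprK. Qed.

Lemma dot_sphere_le c y : sphere y -> `|dot c y| <= n%:R * `|c|.
Proof.
move=> /sphere_norm_le1 y1; rewrite (le_trans (dot_norm_le _ _))//.
by rewrite ler_piMr// mulr_ge0.
Qed.

Lemma expR_dot_sphere_le c y :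
  sphere y -> `|expR (dot c y)| <= expR (n%:R * `|c|).
Proof.
move=> Sy; rewrite ger0_norm ?expR_ge0// ler_expR (le_trans (ler_norm _))//.
exact: dot_sphere_le.
Qed.

Lemma tangent_projE x g : tangent_proj x *m g = g - dot x g *: x.
Proof.
rewrite /tangent_proj mulmxBl mul1mx -mulmxA [x^T *m g]mx11_scalar.
by rewrite mul_mx_scalar.
Qed.

Lemma tangent_proj_norm_le x g : sphere x ->
  `|tangent_proj x *m g| <= n.+1%:R * `|g|.
Proof.
move=> Sx; rewrite tangent_projE (le_trans (ler_normB _ _))//.
rewrite -nat1r mulrDl mul1r lerD2l normrZ -[leRHS]mulr1.
rewrite ler_pM// ?sphere_norm_le1//.
by rewrite dotC dot_sphere_le.
Qed.

End euclidean_theory.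

(** * Continuity of vector functions; compactness of the sphere *)

Section continuous_functions.
Context {R : realType} {T : topologicalType}.
Implicit Types f g : T -> R.

Lemma continuous_mul f g :
  continuous f -> continuous g -> continuous (fun x => f x * g x).
Proof. by move=> cf cg x; exact: (@continuousM _ _ f g x (cf x) (cg x)). Qed.

Lemma continuous_add f g :
  continuous f -> continuous g -> continuous (fun x => f x + g x).
Proof. by move=> cf cg x; exact: (@continuousD _ _ _ f g x (cf x) (cg x)). Qed.

Lemma continuous_sub f g :
  continuous f -> continuous g -> continuous (fun x => f x - g x).
Proof. by move=> cf cg x; exact: (@continuousB _ _ _ f g x (cf x) (cg x)). Qed.

End continuous_functions.

Section euclidean_topology.
Context {R : realType} {n : nat}.

Lemma continuous_coord {T : topologicalType} {m p : nat}
    (f : T -> 'M[R]_(m, p)) :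
  (forall i j, continuous (fun x => f x i j)) -> continuous f.
Proof.
move=> cf x; apply/cvgrPdist_le => /= e e0.
near=> y.
rewrite [leLHS]/Num.norm/= mx_normrE (bigmax_le _ (ltW e0))//= => -[i j] _.
rewrite !mxE/=; move: i j; near: y.
apply: filter_forall => i; apply: filter_forall => j.
exact: ((cvgrPdist_le _ _).1 (cf i j x)).
Unshelve. all: by end_near. Qed.

Lemma continuous_dot {T : topologicalType} {f g : T -> 'cV[R]_n} :
  continuous f -> continuous g -> continuous (fun x => dot (f x) (g x)).
Proof.
move=> cf cg; under eq_fun do rewrite dotE.
apply: (continuous_big (op := +%R)); first exact: add_continuous.
move=> i _ x; apply: cvgM.
- exact: (continuous_comp (cf x) (@coord_continuous _ _ _ i 0 (f x))).
- exact: (continuous_comp (cg x) (@coord_continuous _ _ _ i 0 (g x))).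
Qed.

Lemma continuous_mulmx (A : 'M[R]_n) :
  continuous (mulmx A : 'cV[R]_n -> 'cV[R]_n).
Proof.
apply: continuous_coord => i j x.
have -> : (fun y : 'cV[R]_n => (A *m y) i j) = (fun y => dot (row i A)^T y).
  apply/funext => y; rewrite dotE mxE; apply: eq_bigr => k _.
  by rewrite !mxE (ord1 j).
apply: (@continuous_dot _ (cst _) id); first exact: cst_continuous.
by move=> y; exact: cvg_id.
Qed.

Lemma closed_sphere : closed (sphere : set 'cV[R]_n).
Proof.
have -> : sphere = (fun x => dot x x) @^-1` [set 1] :> set 'cV[R]_n.
  by apply/seteqP; split => x /sphereE.
apply: preimage_closed (@closed_eq _ 1) => //.
by move=> x _; apply: (@continuous_dot _ id id) => y; exact: cvg_id.
Qed.

(** Transposition carries the sphere to a closed bounded set of row vectors, to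
    which Heine-Borel applies. Compactness makes every continuous function
    bounded and integrable on the sphere. *)
Lemma compact_sphere : compact (sphere : set 'cV[R]_n).
Proof.
have cT m p : continuous (@trmx R m p).
  apply: continuous_coord => i j.
  under eq_fun do rewrite mxE.
  exact: coord_continuous.
have -> : sphere = trmx @` (trmx @^-1` sphere) :> set 'cV[R]_n.
  by apply/seteqP; split => [x Sx|_ [x Sx <-]//]; exists x^T; rewrite /= trmxK.
apply: continuous_compact; first by apply: continuous_subspaceT; exact: cT.
apply: bounded_closed_compact; last first.
  by apply: preimage_closed closed_sphere => // x _; exact: cT.
exists 1; split=> // b b1 x /sphere_norm_le1 x1.
apply: le_trans (ltW b1); rewrite -[x]trmxK; apply: le_trans x1.
rewrite [leLHS]/Num.norm/= mx_normrE; apply: bigmax_le => // -[i j] _.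
by rewrite mxE coord_le_norm.
Qed.

End euclidean_topology.

(** * Integration over the sphere *)

Section sphere_integration.
Context {R : realType} {n : nat}.
Local Notation E := (borelE R n).
Local Notation S := (sphere : set E).
Implicit Types (rho nu : {measure set E -> \bar R}) (f g : 'cV[R]_n -> R).

Lemma measurable_continuous f :
  continuous f -> measurable_fun [set: E] (f : E -> R).
Proof.
move=> /continuousP cf; apply: (measurability _ (RGenOpens.measurableE R)).
move=> _ [_ [a [b ->] <-]]; rewrite setTI; apply: sub_sigma_algebra.
exact/cf/interval_open.
Qed.

Lemma measurable_sphere : measurable S.
Proof.
rewrite -[S]setCK; apply: measurableC; apply: sub_sigma_algebra.
exact/closed_openC/closed_sphere.
Qed.

Lemma sphere_bounded f : continuous f ->
  exists2 b, 0 <= b & forall x, sphere x -> `|f x| <= b.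
Proof.
move=> cf.
have /compact_bounded[b [_ fb]] : compact (f @` sphere).
  by apply: continuous_compact (compact_sphere); exact: continuous_subspaceT.
exists (`|b| + 1) => [|x Sx]; first by rewrite addr_ge0.
by apply: fb; [rewrite ltr_pwDr// ler_norm | exists x].
Qed.

Lemma integrable_continuous rho f : sphere_probability rho -> continuous f ->
  rho.-integrable S (EFin \o f).
Proof.
move=> [_ rhoS] cf; apply: measurable_bounded_integrable => //.
- exact: measurable_sphere.
- by rewrite rhoS ltry.
- by apply: measurable_funTS; exact: measurable_continuous.
- have [b _ fb] := sphere_bounded _ cf.
  exists b; split => [|c bc x Sx]; first exact: num_real.
  exact: le_trans (fb x Sx) (ltW bc).
Qed.

Lemma Rintegral_sphere_cst rho a : sphere_probability rho ->
  \int[rho]_(x in S) a = a.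
Proof.
move=> [_ rhoS]; rewrite Rintegral_cst ?rhoS ?mulr1//.
exact: measurable_sphere.
Qed.

Lemma Rintegral_sphereD rho f g : sphere_probability rho ->
    continuous f -> continuous g ->
  \int[rho]_(x in S) (f x + g x) =
  \int[rho]_(x in S) f x + \int[rho]_(x in S) g x.
Proof.
move=> rhoP cf cg; apply: RintegralD; first exact: measurable_sphere.
- exact: integrable_continuous.
- exact: integrable_continuous.
Qed.

Lemma Rintegral_sphereB rho f g : sphere_probability rho ->
    continuous f -> continuous g ->
  \int[rho]_(x in S) (f x - g x) =
  \int[rho]_(x in S) f x - \int[rho]_(x in S) g x.
Proof.
move=> rhoP cf cg; apply: RintegralB; first exact: measurable_sphere.
- exact: integrable_continuous.
- exact: integrable_continuous.
Qed.

Lemma Rintegral_sphereZl rho a f : sphere_probability rho -> continuous f ->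
  \int[rho]_(x in S) (a * f x) = a * \int[rho]_(x in S) f x.
Proof.
move=> rhoP cf; apply: RintegralZl; first exact: measurable_sphere.
exact: integrable_continuous.
Qed.

Lemma Rintegral_sphere_sum rho (I : Type) (r : seq I) (F : I -> 'cV[R]_n -> R) :
    sphere_probability rho -> (forall i, continuous (F i)) ->
  \int[rho]_(x in S) (\sum_(i <- r) F i x) =
  \sum_(i <- r) \int[rho]_(x in S) F i x.
Proof.
move=> rhoP cF; elim: r => [|i r IH].
  under eq_Rintegral do rewrite big_nil.
  by rewrite big_nil Rintegral_sphere_cst.
under eq_Rintegral do rewrite big_cons.
rewrite big_cons -IH Rintegral_sphereD//.
apply: (continuous_big (op := +%R)) => [|j _ x]; last exact: cF.
exact: add_continuous.
Qed.

Lemma norm_Rintegral_sphere_le rho f b : sphere_probability rho ->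
    continuous f -> (forall x, sphere x -> `|f x| <= b) ->
  `|\int[rho]_(x in S) f x| <= b.
Proof.
move=> rhoP cf fb; apply: le_trans (le_normr_Rintegral measurable_sphere _) _.
  exact: integrable_continuous.
rewrite -[leRHS](Rintegral_sphere_cst _ b rhoP).
apply: le_Rintegral => //; first exact: measurable_sphere.
- apply: (@integrable_continuous _ (fun x => `|f x|)) => // x.
  exact: (continuous_comp (cf x) (@norm_continuous _ _ (f x))).
- by apply: integrable_continuous => //; exact: cst_continuous.
Qed.

Lemma eq_measure_Rintegral rho nu f :
  (forall A, measurable A -> rho A = nu A) ->
  \int[rho]_(x in S) f x = \int[nu]_(x in S) f x.
Proof.
by move=> rhonu; congr fine; apply: eq_measure_integral => A mA _; exact: rhonu.
Qed.

End sphere_integration.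

Section integral_symmetric_atoms.
Context {R : realType} {n : nat}.
Local Notation E := (borelE R n).
Local Notation S := (sphere : set E).
Context (Z : {fset 'cV[R]_n}) (t : 'cV[R]_n -> {nonneg R}).
Context (Z_sphere : forall z, z \in Z -> sphere z).
Context (sum_t : \sum_(z <- Z) (t z)%:num = 1).

Let mu : {measure set E -> \bar R} := symmetric_atoms Z t.

Lemma symmetric_atoms_mass (A : set E) : sphere `<=` A ->
  symmetric_atoms Z t A = 1%E.
Proof.
move=> SA; rewrite /symmetric_atoms.
have -> : (\sum_(z <- Z) (t z)%:num%:E * (\d_(z : E) A + \d_(- z : E)%R A) =
           \sum_(z <- Z) ((t z)%:num * 2)%:E)%E.
  apply: eq_big_seq => z /Z_sphere Sz; rewrite !diracE.
  rewrite !mem_set; [by rewrite -EFinD -EFinM | | exact: SA].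
  by apply/SA/sphereN.
by rewrite sumEFin -mulr_suml sum_t mul1r -EFinM mulVf.
Qed.

Lemma sphere_probability_symmetric_atoms : sphere_probability mu.
Proof. by split; apply: symmetric_atoms_mass. Qed.

(** [symmetric_atoms] agrees on measurable sets with an explicit combination of
    Dirac measures, and integrals only depend on these values. *)
Let ge0_integral_symmetric_atoms (f : 'cV[R]_n -> R) :
    continuous f -> (forall x, 0 <= f x) ->
  (\int[mu]_(x in S) (f x)%:E =
   (2^-1 * \sum_(z <- Z) (t z)%:num * (f z + f (- z)))%:E)%E.
Proof.
move=> cf f0.
have half_ge0 : (0 <= 2^-1 :> R)%R by rewrite invr_ge0.
pose atom z : {measure set E -> \bar R} :=
  mscale (t z) (measure_add (dirac (z : E)) (dirac ((- z)%R : E))).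
pose total : {measure set E -> \bar R} :=
  mscale (NngNum half_ge0) (msum (fun i => atom (nth 0%R Z i)) (size Z)).
have mS := @measurable_sphere R n.
have /measurable_EFinP mf : measurable_fun S (f : E -> R).
  by apply: measurable_funTS; exact: measurable_continuous.
have f0E (x : E) : S x -> (0 <= (f x)%:E)%E by rewrite lee_fin.
have -> : (\int[mu]_(x in S) (f x)%:E = \int[total]_(x in S) (f x)%:E)%E.
  apply: eq_measure_integral => A mA _; rewrite /mu/= /symmetric_atoms /total/=.
  rewrite /mscale/= /msum; congr (_ * _)%E.
  rewrite (big_nth 0%R) big_mkord; apply: eq_bigr => i _.
  by rewrite /atom/= /mscale/=; congr (_ * _)%E; exact/esym/measure_addE.
rewrite ge0_integral_mscale// ge0_integral_measure_sum// EFinM; congr (_ * _)%E.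
rewrite -sumEFin (big_nth 0%R) big_mkord; apply: eq_bigr => i _.
rewrite ge0_integral_mscale// ge0_integral_measure_add// !integral_dirac//.
have Sz : S (nth 0 Z i) by apply: Z_sphere; rewrite mem_nth.
by rewrite !diracE !mem_set ?mul1e//; exact: sphereN.
Qed.

(** [f = (|f| + f) - |f|] reduces the formula to nonnegative integrands. *)
Lemma Rintegral_symmetric_atoms (f : 'cV[R]_n -> R) : continuous f ->
  \int[mu]_(x in S) f x = 2^-1 * \sum_(z <- Z) (t z)%:num * (f z + f (- z)).
Proof.
move=> cf; have muP := sphere_probability_symmetric_atoms.
have c_abs : continuous (fun x => `|f x|).
  by move=> x; exact: (continuous_comp (cf x) (@norm_continuous _ _ (f x))).
have c_add : continuous (fun x => `|f x| + f x).
  exact: continuous_add.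
have -> : \int[mu]_(x in S) f x =
    \int[mu]_(x in S) (`|f x| + f x) - \int[mu]_(x in S) `|f x|.
  by rewrite Rintegral_sphereD// addrAC subrr add0r.
rewrite /Rintegral !ge0_integral_symmetric_atoms//=.
  rewrite -mulrBr; congr (_ * _); rewrite -sumrB.
  by apply: eq_bigr => z _; ring.
by move=> x; rewrite -lerBlDr sub0r -normrN ler_norm.
Qed.

End integral_symmetric_atoms.

(** * Differentials from quadratic remainders *)

Section quadratic_remainder.
Context {R : realType} {V : normedModType R}.

(** A quadratic remainder is little-o of the increment. *)
Lemma is_diff_quadratic (f : V -> R) (df : {linear V -> R}) x (r b : R) :
    continuous df -> 0 < r ->
    (forall h, `|h| <= r -> `|f (x + h) - f x - df h| <= b * `|h| ^+ 2) ->
  is_diff x f df.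
Proof.
move=> cdf r0 fb.
have f_o : f \o shift x = cst (f x) + df +o_ 0 id.
  apply/eqaddoP => _/posnumP[e]; near=> h.
  have hr : `|h| <= r by near: h; exact: nbhs0_le.
  have hb : `|h| <= e%:num / (`|b| + 1).
    by near: h; apply: nbhs0_le; rewrite divr_gt0// ltr_pwDr.
  rewrite [X in `|X|](_ : _ = f (x + h) - f x - df h); last first.
    by rewrite -addrA -opprD [x + h]addrC.
  rewrite (le_trans (fb _ hr))// expr2 mulrA ler_wpM2r//.
  rewrite ler_pdivlMr in hb; last by rewrite ltr_pwDr.
  apply: le_trans hb; rewrite mulrC ler_wpM2l//.
  by rewrite (le_trans (ler_norm _))// lerDl.
have dfE := diff_unique cdf f_o.
by split => //; apply/diff_locallyP; rewrite dfE.
Unshelve. all: by end_near. Qed.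

End quadratic_remainder.

Lemma is_derive0_quadratic (R : realType) (f : R -> R) (b : R) :
  (forall t, `|f t| <= b * `|t| ^+ 2) -> is_derive (0 : R) 1 f 0.
Proof.
move=> fb.
have f0 : f 0 = 0.
  by apply/eqP; rewrite -normr_le0 (le_trans (fb 0))// normr0 expr0n mulr0.
have : is_diff (0 : R) f (\0 : {linear R -> R}).
  apply: (@is_diff_quadratic _ _ _ _ _ 1 b) => [|//|h _].
    exact: cst_continuous.
  by rewrite add0r f0 !subr0.
move=> d0; apply: DeriveDef; first exact/derivable1_diffP.
by rewrite deriveE// diff_val.
Qed.

(** Both sides come from [1 + u <= exp u]: applied to [- u] it gives
    [exp u <= 1 / (1 - u)], whose remainder is [u ^+ 2 / (1 - u)]. *)
Lemma expR_remainder (R : realType) (u : R) :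
  u <= 2^-1 -> `|expR u - 1 - u| <= 2 * u ^+ 2.
Proof.
move=> u2.
have lb := expR_ge1Dx u; have := expR_ge1Dx (- u); rewrite expRN => ub.
have e0 := expR_gt0 u; have u1 : 0 < 1 - u by lra.
have {}ub : expR u * (1 - u) <= 1 by rewrite -ler_pdivlMl// mulr1.
rewrite ger0_norm; last by lra.
rewrite -subr_ge0 -(pmulr_lge0 _ u1); nra.
Qed.

Section gradients.
Context {R : realType} {n : nat}.
Implicit Types (c g x y : 'cV[R]_n) (phi psi : 'cV[R]_n -> R).

Lemma dot_is_linear c : linear (dot c : 'cV[R]_n -> R).
Proof. by move=> a x y; rewrite dotDr dotZr. Qed.

HB.instance Definition _ c :=
  GRing.isLinear.Build R 'cV[R]_n R _ (dot c) (dot_is_linear c).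

Lemma continuous_dotr c : continuous (dot c).
Proof.
apply: (@continuous_dot _ _ _ (cst c) id); first exact: cst_continuous.
by move=> x; exact: cvg_id.
Qed.

Lemma is_diff_dot c x : is_diff x (dot c) (dot c).
Proof.
apply: DiffDef; first exact: (linear_differentiable _ (@continuous_dotr c)).
exact: (diff_lin _ (@continuous_dotr c)).
Qed.

Lemma gradient_diff phi g x : is_diff x phi (dot g) -> gradient phi x = g.
Proof.
move=> dphi; apply/matrixP => i j; rewrite (ord1 j) mxE deriveE// diff_val.
by rewrite dotC dot_delta.
Qed.

Lemma is_diff_gradient phi x : differentiable phi x ->
  is_diff x phi (dot (gradient phi x)).
Proof.
move=> dphi; apply: DiffDef => //; apply/funext => h.
have -> : h = \sum_i h i 0 *: delta_mx i 0.
  by rewrite [LHS]matrix_sum_delta; apply: eq_bigr => i _; rewrite big_ord1.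
rewrite !linear_sum; apply: eq_bigr => i _; rewrite !linearZ/=.
by rewrite -deriveE// dotC dot_delta mxE.
Qed.

Lemma C1_diff phi (g : 'cV[R]_n -> 'cV[R]_n) :
  (forall x, is_diff x phi (dot (g x))) -> continuous g ->
  C1 phi /\ gradient phi = g.
Proof.
move=> dphi cg.
have gE : gradient phi = g by apply/funext => x; exact: gradient_diff.
by split=> //; split=> [x|]; [exact: ex_diff | rewrite gE].
Qed.

Lemma C1_continuous phi : C1 phi -> continuous phi.
Proof. by move=> [dphi _] x; exact: differentiable_continuous. Qed.

Lemma C1B phi psi : C1 phi -> C1 psi ->
  C1 (fun x => phi x - psi x) /\
  gradient (fun x => phi x - psi x) =
    (fun x => gradient phi x - gradient psi x).
Proof.
move=> [dphi cphi] [dpsi cpsi]; apply: C1_diff => [x|x]; last first.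
  exact: (@continuousB _ _ _ (gradient phi) (gradient psi) x (cphi x) (cpsi x)).
have d1 := @is_diff_gradient _ _ (dphi x).
have d2 := @is_diff_gradient _ _ (dpsi x).
apply: (@is_diff_eq _ _ _ (phi - psi) _ _ x (is_diffB d1 d2)).
by apply/funext => h; rewrite dotDl dotNl.
Qed.

End gradients.

(** * The Laplace transform of a measure and its potential *)

Section laplace_transform.
Context {R : realType} {n : nat}.
Local Notation E := (borelE R n).
Local Notation S := (sphere : set E).
Implicit Types (rho : {measure set E -> \bar R}) (q : 'cV[R]_n -> R).
Implicit Types (c d h x : 'cV[R]_n) (D : 'M[R]_n).

Lemma continuous_expR_dot c : continuous (fun y => expR (dot c y)).
Proof.
move=> y; apply: (continuous_comp (@continuous_dotr _ _ c y)).
exact: continuous_expR.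
Qed.

(** The weight [q] makes the family stable under differentiation in [c]: the
    derivative in direction [h] has weight [q y * dot h y]. *)
Definition laplace rho q c : R := \int[rho]_(y in S) (expR (dot c y) * q y).

Definition laplace_grad rho q c : 'cV[R]_n :=
  \col_i laplace rho (fun y => q y * y i 0) c.

Lemma dot_laplace_grad rho q c h : sphere_probability rho -> continuous q ->
  dot (laplace_grad rho q c) h =
  \int[rho]_(y in S) (expR (dot c y) * q y * dot h y).
Proof.
move=> rhoP cq.
have cK i : continuous (fun y => expR (dot c y) * (q y * y i 0)).
  apply: continuous_mul; first exact: continuous_expR_dot.
  by apply: continuous_mul => //; exact: coord_continuous.
have -> : \int[rho]_(y in S) (expR (dot c y) * q y * dot h y) =
    \int[rho]_(y in S) \sum_i h i 0 * (expR (dot c y) * (q y * y i 0)).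
  apply: eq_Rintegral => y _; rewrite (dotE h) mulr_sumr.
  by apply: eq_bigr => i _; rewrite mulrCA -mulrA.
rewrite (Rintegral_sphere_sum _ _ _
  (fun i y => h i 0 * (expR (dot c y) * (q y * y i 0)))) => //.
  rewrite dotE; apply: eq_bigr => i _.
  by rewrite Rintegral_sphereZl// mxE mulrC.
move=> i; apply: (@continuous_mul _ _ (cst (h i 0))) => //.
exact: cst_continuous.
Qed.

Lemma laplace_grad_coord rho c i :
  laplace_grad rho (cst 1) c i 0 = \int[rho]_(y in S) (expR (dot c y) * y i 0).
Proof. by rewrite mxE; apply: eq_Rintegral => y _; rewrite mul1r. Qed.

(** Differentiation under the integral sign:
    [exp ((c + h).y) - exp (c.y) - exp (c.y) (h.y)
       = exp (c.y) (exp (h.y) - 1 - h.y)]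
    is quadratic in [h], uniformly for [y] on the sphere. *)
Lemma is_diff_laplace rho q c : sphere_probability rho -> continuous q ->
  is_diff c (laplace rho q) (dot (laplace_grad rho q c)).
Proof.
move=> rhoP cq; have [b b0 qb] := sphere_bounded _ cq.
have cE d : continuous (fun y => expR (dot d y) * q y).
  by apply: continuous_mul => //; exact: continuous_expR_dot.
(* This radius ensures [dot h y <= 1 / 2], as [expR_remainder] requires. *)
apply: (@is_diff_quadratic _ _ _ _ _ (2 * n.+1%:R)^-1
  (2 * expR (n%:R * `|c|) * b * n%:R ^+ 2)) => [||h hr].
- exact: continuous_dotr.
- by rewrite invr_gt0 mulr_gt0.
have cEh : continuous (fun y => expR (dot c y) * q y * dot h y).
  by apply: continuous_mul => //; exact: continuous_dotr.
rewrite /= dot_laplace_grad// -!Rintegral_sphereB//; last first.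
  exact: continuous_sub.
apply: norm_Rintegral_sphere_le => // [|y Sy].
  by apply: continuous_sub => //; exact: continuous_sub.
have -> : expR (dot (c + h) y) * q y - expR (dot c y) * q y -
    expR (dot c y) * q y * dot h y =
    expR (dot c y) * q y * (expR (dot h y) - 1 - dot h y).
  by rewrite dotDl expRD; ring.
have hy := dot_sphere_le h _ Sy.
have hy2 : dot h y <= 2^-1.
  rewrite (le_trans (ler_norm _))// (le_trans hy)//.
  rewrite (@le_trans _ _ (n.+1%:R * (2 * n.+1%:R)^-1))//.
    by rewrite ler_pM// ler_nat.
  by rewrite invfM mulrCA divff ?mulr1// pnatr_eq0.
rewrite !normrM.
have -> : 2 * expR (n%:R * `|c|) * b * n%:R ^+ 2 * `|h| ^+ 2 =
  expR (n%:R * `|c|) * b * (2 * (n%:R * `|h|) ^+ 2) by ring.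
apply: ler_pM; rewrite ?mulr_ge0//.
  by rewrite ler_pM// ?qb//; exact: expR_dot_sphere_le.
rewrite (le_trans (expR_remainder _ _ hy2))// ler_wpM2l//.
by rewrite -(real_normK (num_real (dot h y))) lerXn2r ?nnegrE ?mulr_ge0.
Qed.

(** The partial derivatives are again Laplace transforms, hence differentiable,
    hence continuous. *)
Lemma C1_laplace rho q : sphere_probability rho -> continuous q ->
  C1 (laplace rho q) /\ gradient (laplace rho q) = laplace_grad rho q.
Proof.
move=> rhoP cq; apply: C1_diff => [c|]; first exact: is_diff_laplace.
apply: continuous_coord => i j; under eq_fun do rewrite mxE.
have cqi : continuous (fun y => q y * y i 0).
  by apply: continuous_mul => //; exact: coord_continuous.
move=> c; have [dc _] := is_diff_laplace _ _ c rhoP cqi.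
exact: differentiable_continuous.
Qed.

(** The energy of [rho] is the [rho]-integral of this function. *)
Definition potential D rho x : R := \int[rho]_(y in S) expR (dot x (D *m y)).

Lemma potentialE D rho : potential D rho = laplace rho (cst 1) \o mulmx D^T.
Proof.
apply/funext => x; apply: eq_Rintegral => y _.
by rewrite mulr1 dot_mulmxr.
Qed.

Lemma C1_potential D rho : sphere_probability rho ->
  C1 (potential D rho) /\
  gradient (potential D rho) =
    fun x => D *m laplace_grad rho (cst 1) (D^T *m x).
Proof.
move=> rhoP.
have c1 : continuous (cst 1 : 'cV[R]_n -> R) by exact: cst_continuous.
have [[_ cL] gL] := C1_laplace _ _ rhoP c1.
rewrite gL in cL.
have cLD : continuous (laplace_grad rho (cst 1) \o mulmx D^T).
  by move=> x; exact: (continuous_comp (continuous_mulmx D^T x) (cL _)).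
rewrite potentialE; apply: C1_diff => x; last first.
  exact: (continuous_comp (cLD x) (continuous_mulmx D _)).
have dD : is_diff x (mulmx D^T : 'cV[R]_n -> 'cV[R]_n) (mulmx D^T).
  apply: DiffDef.
    exact: linear_differentiable (@continuous_mulmx _ _ D^T).
  exact: (diff_lin _ (@continuous_mulmx _ _ D^T)).
apply: is_diff_eq (is_diff_comp dD (is_diff_laplace _ _ _ rhoP c1)) _.
by apply/funext => h; rewrite /= dot_mulmxr trmxK.
Qed.

End laplace_transform.

(** * Weak solutions are Lipschitz in time *)

Lemma mean_value_le (R : realType) (f df : R -> R) (b s t : R) :
    (forall x : R, is_derive x 1 f (df x)) -> (forall x, `|df x| <= b) ->
  `|f t - f s| <= b * `|t - s|.
Proof.
move=> fdf dfb; wlog st : s t / s <= t.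
  by case: (leP s t) => [|/ltW] st; [|rewrite distrC [X in _ * X]distrC]; exact.
have cf : {within `[s, t], continuous f}.
  apply: continuous_subspaceT => x; apply: differentiable_continuous.
  by apply/derivable1_diffP; have [] := fdf x.
have [x _ ->] := MVT_segment st (fun x _ => fdf x) cf.
by rewrite normrM ler_wpM2r.
Qed.

Lemma continuous_lipschitz (R : realType) (V W : normedModType R) (f : V -> W) :
  lipschitz f -> continuous f.
Proof.
move=> /pinfty_ex_gt0[k k0 fk] x; apply/cvgrPdist_le => e e0.
near=> y; have := fk (x, y) (conj I I) => /= /le_trans; apply.
rewrite mulrC -ler_pdivlMr//; near: y.
by apply: (@cvgr_dist_le _ _ _ _ _ id x); [exact: cvg_id | rewrite divr_gt0].
Unshelve. all: by end_near. Qed.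

Section weak_solution.
Context {R : realType} {n : nat}.
Local Notation E := (borelE R n).
Local Notation S := (sphere : set E).
Context (V : 'cV[R]_n -> 'cV[R]_n) (lipV : lipschitz V).

Lemma dot_tangent_proj (x g v : 'cV[R]_n) :
  dot (tangent_proj x *m g) v = dot g v - dot x g * dot x v.
Proof. by rewrite tangent_projE dotDl dotNl dotZl. Qed.

Lemma continuous_tangential (phi : 'cV[R]_n -> R) : C1 phi ->
  continuous (fun x => dot (tangent_proj x *m gradient phi x) (V x)).
Proof.
move=> [_ cphi]; have cV := @continuous_lipschitz _ _ _ _ lipV.
have cid : continuous (@id 'cV[R]_n) by move=> x; exact: cvg_id.
under eq_fun do rewrite dot_tangent_proj.
apply: continuous_sub; first exact: continuous_dot.
by apply: continuous_mul; exact: (@continuous_dot _ _ _ id).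
Qed.

(** The weak equation gives the time derivative of [phi]-averages, which is at
    most [M * b] because [V] is bounded on the compact sphere; conclude by the
    mean value theorem. The constant [M] only depends on [V], so the bound
    also controls test functions that vary with time or position. *)
Lemma weak_solution_time_lipschitz : exists2 M, 0 <= M &
  forall mu (mu_ : R -> {measure set E -> \bar R}), weak_solution V mu mu_ ->
  forall phi b, C1 phi -> (forall x, sphere x -> `|gradient phi x| <= b) ->
  forall t, `|\int[mu_ t]_(x in S) phi x - \int[mu_ 0]_(x in S) phi x| <=
    M * b * `|t|.
Proof.
have cV := @continuous_lipschitz _ _ _ _ lipV.
have cnV : continuous (fun x => `|V x|).
  by move=> x; exact: (continuous_comp (cV x) (@norm_continuous _ _ (V x))).
have [K K0 VK] := sphere_bounded _ cnV.
exists (n%:R * n.+1%:R * K) => [|mu mu_ [mu_P _ dmu] phi b phiC1 phib t].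
  by rewrite !mulr_ge0.
rewrite -[X in _ * `|X|]subr0.
apply: (@mean_value_le _ (fun s => \int[mu_ s]_(x in S) phi x)) => s.
  exact: dmu.
apply: norm_Rintegral_sphere_le => //; first exact: continuous_tangential.
move=> x Sx; rewrite (le_trans (dot_norm_le _ _))//.
have -> : n%:R * n.+1%:R * K * b = n%:R * (n.+1%:R * b) * K by ring.
rewrite ler_pM//; last by rewrite -[leLHS]normr_id VK.
rewrite ler_wpM2l// (le_trans (tangent_proj_norm_le _ _ Sx))// ler_wpM2l//.
exact: phib.
Qed.

End weak_solution.

(** * The gradients of the potentials are Lipschitz in time *)

Section second_order.
Context {R : realType} {n : nat}.
Local Notation E := (borelE R n).
Implicit Types (c x y : 'cV[R]_n) (D : 'M[R]_n).

(** The partial derivatives in [c] of the kernel [exp (c.y)], seen as test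
    functions of [y]: averaging them yields the gradient of the potential. *)
Lemma C1_expR_coord c i : let psi y := expR (dot c y) * y i 0 in
  C1 psi /\
  gradient psi = fun y => expR (dot c y) *: (delta_mx i 0 + y i 0 *: c).
Proof.
move=> psi; apply: C1_diff => [y|]; last first.
  apply: continuous_coord => k j; under eq_fun do rewrite !mxE.
  apply: continuous_mul; first exact: continuous_expR_dot.
  move=> y; apply: (@continuousD _ _ _ (cst _) (fun y => y i 0 * c k j)).
    exact: cst_continuous.
  apply: continuous_mul; first exact: coord_continuous.
  exact: cst_continuous.
have de : is_diff (dot c y) expR ( *:%R^~ (expR (dot c y)) : R -> R).
  have [dE vE] := is_derive_expR (dot c y).
  apply: DiffDef; first exact/derivable1_diffP.
  apply/funext => u; rewrite -[u in LHS]mulr1 linearZ/= -deriveE ?vE//.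
  exact/derivable1_diffP.
have dd := @is_diff_comp _ _ _ _ _ _ _ _ y (is_diff_dot c y) de.
have -> : psi = (expR \o dot c) * dot (delta_mx i 0).
  by apply/funext => z; congr (_ * _); rewrite dot_delta.
apply: is_diff_eq (is_diffM dd (is_diff_dot (delta_mx i 0) y)) _.
apply/funext => h; rewrite dotZl dotDl dotZl.
rewrite [LHS]/(expR (dot c y) * dot (delta_mx i 0) h +
  dot (delta_mx i 0) y * (dot c h * expR (dot c y))).
by rewrite !dot_delta mulrDr mulrA [X in _ + X]mulrC.
Qed.

Lemma norm_gradient_expR_coord_le c i y : sphere y ->
  `|expR (dot c y) *: (delta_mx i 0 + y i 0 *: c)| <=
  expR (n%:R * `|c|) * (1 + `|c|).
Proof.
move=> Sy; rewrite normrZ ler_pM ?expR_dot_sphere_le//.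
rewrite (le_trans (ler_normD _ _))// lerD//.
  by apply: norm_le_coord => // j; rewrite mxE normr_nat; case: (_ && _).
rewrite normrZ -[leRHS]mul1r ler_wpM2r//.
exact: le_trans (coord_le_norm _ _ _ _ _) (sphere_norm_le1 _ Sy).
Qed.

(** At a fixed point [x], each coordinate of the gradient is, up to [D], the
    average of one test function of [C1_expR_coord] with [c = D^T x], so the
    time-Lipschitz bound applies. Since [c] stays bounded when [x] runs through
    the sphere, so do the gradients of these test functions. *)
Lemma gradient_potential_time_lipschitz V D : lipschitz V ->
  exists2 b, 0 <= b &
  forall mu (mu_ : R -> {measure set E -> \bar R}), weak_solution V mu mu_ ->
  forall t x, sphere x ->
  `|gradient (potential D (mu_ t)) x - gradient (potential D (mu_ 0)) x| <=
  b * `|t|.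
Proof.
move=> lipV; have [M M0 MP] := weak_solution_time_lipschitz _ lipV.
pose L := n%:R * `|D^T|; pose N := expR (n%:R * L) * (1 + L).
have L0 : 0 <= L by rewrite mulr_ge0.
have N0 : 0 <= N by rewrite mulr_ge0 ?expR_ge0// addr_ge0.
exists (n%:R * `|D| * (M * N)) => [|mu mu_ ws t x Sx].
  by rewrite (mulr_ge0 _ (mulr_ge0 M0 N0))// mulr_ge0.
have mu_P s : sphere_probability (mu_ s) by case: ws.
have [_ ->] := C1_potential D _ (mu_P t).
have [_ ->] := C1_potential D _ (mu_P 0).
set c := D^T *m x.
have cL : `|c| <= L.
  rewrite (le_trans (mulmx_norm_le _ _))// -[leRHS]mulr1 ler_wpM2l//.
  exact: sphere_norm_le1.
rewrite -mulmxBr (le_trans (mulmx_norm_le _ _))// -[leRHS]mulrA.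
rewrite ler_wpM2l ?mulr_ge0//.
apply: norm_le_coord => [|i]; first by rewrite (mulr_ge0 (mulr_ge0 M0 N0)).
have [psiC1 gpsi] := C1_expR_coord c i.
rewrite mxE [X in _ + X]mxE !laplace_grad_coord.
apply: (MP _ _ ws _ N psiC1) => y Sy; rewrite gpsi.
rewrite (le_trans (norm_gradient_expR_coord_le _ _ _ Sy))//.
by rewrite ler_pM ?expR_ge0 ?addr_ge0 ?ler_expR ?ler_wpM2l ?lerD2l.
Qed.

End second_order.

(** * Symmetric measures on orthogonal eigenvectors *)

Section eigenvector_atoms.
Context {R : realType} {n : nat}.
Local Notation E := (borelE R n).
Local Notation S := (sphere : set E).
Implicit Types (rho : {measure set E -> \bar R}).
Context (D : 'M[R]_n) (Z : {fset 'cV[R]_n}) (t : 'cV[R]_n -> {nonneg R}).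
Context (symD : D^T = D).
Context (Z_sphere : forall z, z \in Z -> sphere z).
Context (sum_t : \sum_(z <- Z) (t z)%:num = 1).

Local Notation mu := (symmetric_atoms Z t).
Let muP : sphere_probability mu :=
  sphere_probability_symmetric_atoms _ _ Z_sphere sum_t.

(** Symmetry of the kernel and exchange of the integrals. As one of the measures
    is finitely supported, linearity replaces Fubini's theorem. *)
Lemma potential_symmetric_atoms_duality rho : sphere_probability rho ->
  \int[mu]_(x in S) potential D rho x = \int[rho]_(x in S) potential D mu x.
Proof.
move=> rhoP.
have cK (c : 'cV[R]_n) : continuous (fun x => expR (dot c x)).
  exact: continuous_expR_dot.
have [C1rho _] := C1_potential D _ rhoP.
have potentialDE c :
    potential D rho c = \int[rho]_(x in S) expR (dot (D *m c) x).
  by apply: eq_Rintegral => x _; rewrite dot_mulmxr symD.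
have crho := C1_continuous _ C1rho.
rewrite (Rintegral_symmetric_atoms _ _ Z_sphere sum_t _ crho).
pose K2 z x : R := expR (dot (D *m z) x) + expR (dot (D *m - z) x).
pose F z x : R := (t z)%:num * K2 z x.
have cK2 z : continuous (K2 z).
  by apply: continuous_add; exact: cK.
have cF z : continuous (F z).
  apply: (@continuous_mul _ _ (cst _)) => //; exact: cst_continuous.
have -> : \int[rho]_(x in S) potential D mu x =
    \int[rho]_(x in S) (2^-1 * \sum_(z <- Z) F z x).
  apply: eq_Rintegral => x _.
  rewrite [LHS](Rintegral_symmetric_atoms _ _ Z_sphere sum_t); last first.
    by under eq_fun do rewrite dot_mulmxr; exact: cK.
  by congr (_ * _); apply: eq_bigr => z _; rewrite /F /K2 !(dotC x).
rewrite Rintegral_sphereZl//; last first.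
  apply: (continuous_big (op := +%R)) => [|z _]; last exact: cF.
  exact: add_continuous.
congr (_ * _); rewrite Rintegral_sphere_sum//; apply: eq_bigr => z _.
rewrite /F (Rintegral_sphereZl _ _ _ rhoP (cK2 z)) /K2.
by rewrite (Rintegral_sphereD _ _ _ rhoP (cK _) (cK _)) !potentialDE.
Qed.

Context (Z_orth : forall w z,
  w \in Z -> z \in Z -> z != w -> dot w z = 0).

(** In the sum over the atoms [w] and [- w], the weights [exp (a z.w)] and
    [exp (- a z.w)] are both [1] when [w] is orthogonal to [z], so the vectors
    [w] and [- w] cancel: only the atoms on the line of [z] contribute. *)
Lemma laplace_grad_symmetric_atoms_line a z : z \in Z ->
  exists k, laplace_grad mu (cst 1) (a *: z) = k *: z.
Proof.
move=> zZ.
exists (2^-1 * ((t z)%:num * (expR a - expR (- a)))).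
apply/matrixP => i j; rewrite (ord1 j) laplace_grad_coord mxE.
rewrite (Rintegral_symmetric_atoms _ _ Z_sphere sum_t
  (fun y => expR (dot (a *: z) y) * y i 0)); last first.
  by apply: C1_continuous; have [] := C1_expR_coord (a *: z) i.
rewrite (big_rem z)//= big1_seq ?addr0 => [|w /andP[_]]; last first.
  rewrite (mem_rem_uniq _ (fset_uniq Z)) inE => /andP[wz wZ].
  by rewrite dotNr dotZl Z_orth// mulr0 oppr0 expR0 !mul1r mxE subrr mulr0.
have /sphereE zz := Z_sphere _ zZ.
by rewrite dotNr dotZl zz mulr1 mxE; ring.
Qed.

Context (Z_eigen : forall z, z \in Z -> eigenvector D z).

(** [D z] is a multiple of [z], so the gradient of the potential at [z] is [D]
    applied to a vector on the line of [z]: it is normal to the sphere. *)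
Lemma tangential_gradient_potential_atoms z : z \in Z ->
  tangent_proj z *m gradient (potential D mu) z = 0 /\
  tangent_proj (- z) *m gradient (potential D mu) (- z) = 0.
Proof.
move=> zZ; have [_ ->] := C1_potential D _ muP; rewrite symD.
have [_ [a Dz]] := Z_eigen _ zZ; have /sphereE zz := Z_sphere _ zZ.
have [k1 k1E] := laplace_grad_symmetric_atoms_line a _ zZ.
have [k2 k2E] := laplace_grad_symmetric_atoms_line (- a) _ zZ.
rewrite mulmxN Dz -scaleNr k1E k2E -!scalemxAr Dz -!scalemxAr !tangent_projE.
by rewrite dotNl zz scaleN1r opprK scale1r subrr !scaler0.
Qed.

End eigenvector_atoms.

Theorem lemma4p7 (R : realType) (n : nat) (D : 'M[R]_n)
    (Z : {fset 'cV[R]_n}) (t : 'cV[R]_n -> {nonneg R})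
    (symD : D^T = D)
    (Z_sphere : forall z, z \in Z -> sphere z)
    (Z_eigen : forall z, z \in Z -> eigenvector D z)
    (Z_orth : forall w z, w \in Z -> z \in Z -> z != w -> dot w z = 0)
    (sum_t : \sum_(z <- Z) (t z)%:num = 1) :
  stationary_point D (symmetric_atoms Z t).
Proof.
set mu := symmetric_atoms Z t.
have muP : sphere_probability mu by exact: sphere_probability_symmetric_atoms.
split=> // V lipV mu_ ws; have [mu_P mu0 dmu] := ws.
have C1h rho (rhoP : sphere_probability rho) := (C1_potential D rho rhoP).1.
have hmu0 : potential D (mu_ 0) = potential D mu.
  by apply/funext => x; exact: eq_measure_Rintegral.
pose G s := \int[mu_ s]_(x in (sphere : set (borelE R n))) potential D mu x.
pose gap s x := potential D (mu_ s) x - potential D mu x.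
pose rest s := \int[mu_ s]_(x in (sphere : set (borelE R n))) gap s x -
  \int[mu_ 0]_(x in (sphere : set (borelE R n))) gap s x.
(* Expand the energy around [mu], using [potential_symmetric_atoms_duality]
   for the two cross terms. *)
have energyE s : energy D (mu_ s) = - G 0 + (G s + G s) + rest s.
  have ch r : continuous (potential D (mu_ r)).
    by apply: C1_continuous; exact: C1h.
  have cmu : continuous (potential D mu).
    by apply: C1_continuous; exact: C1h.
  rewrite /rest /gap !Rintegral_sphereB//.
  rewrite (eq_measure_Rintegral _ _ (potential D (mu_ s)) mu0).
  rewrite potential_symmetric_atoms_duality// -/(G s) -/(G 0).
  rewrite -[energy _ _]/(\int[mu_ s]_(x in sphere) potential D (mu_ s) x).
  by ring.
have dG : is_derive (0 : R) 1 G 0.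
  apply: is_derive_eq (dmu _ (C1h _ muP) 0) _.
  rewrite (eq_measure_Rintegral _ _ _ mu0).
  rewrite Rintegral_symmetric_atoms//; last first.
    by apply: continuous_tangential => //; exact: C1h.
  rewrite big1_seq ?mulr0// => z /andP[_ zZ].
  have [-> ->] := tangential_gradient_potential_atoms
    _ _ _ symD Z_sphere sum_t Z_orth Z_eigen _ zZ.
  by rewrite !(dotC 0) -(scale0r 0) !dotZr !mul0r addr0 mulr0.
(* The gradient of [gap s] is of order [s] on the sphere, and pairing [gap s]
   with the difference of the measures gains a second factor of order [s]. *)
have drest : is_derive (0 : R) 1 rest 0.
  have [b b0 gapb] := gradient_potential_time_lipschitz V D lipV.
  have [M M0 MP] := weak_solution_time_lipschitz _ lipV.
  apply: (@is_derive0_quadratic _ _ (M * b)) => s.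
  have [C1gap ggap] := C1B _ _ (C1h _ (mu_P s)) (C1h _ muP).
  rewrite expr2 !mulrA -(mulrA M); apply: (MP _ _ ws _ _ C1gap) => x Sx.
  by rewrite ggap -hmu0; exact: gapb ws s x Sx.
rewrite (_ : (fun s => _) = cst (- G 0) + (G + G) + rest); last exact/funext.
have dconst := is_derive_cst (- G 0) (0 : R) 1.
apply: is_derive_eq (is_deriveD (is_deriveD dconst (is_deriveD dG dG)) drest) _.
by rewrite !addr0.
Qed.
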